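(* Let $r\in\mathbb N$. For every $n\in\mathbb N_0$, \[ p_e(n,2r)=p_o(n,2r)+q_o(n,r), \] where $p_e(n,2r)$ (resp. $p_o(n,2r)$) is the number of partitions of $n$ (all parts allowed) in which the number of parts divisible by $2r$ (counted with multiplicity) is even (resp. odd), and $q_o(n,r)$ is the number of partitions of $n$ in which no part is divisible by $2r$ and the parts divisible by $r$ are distinct (equivalently, all parts divisible by $r$ are distinct odd multiples of $r$).
   Context: A partition of $n$ is a non-increasing sequence of positive integers summing to $n$; the empty partition is the unique partition of $0$. *)

(* Defs.v *)
From HB Require Import structures.
From mathcomp Require Import all_boot.

Set Implicit Arguments.
Unset Strict Implicit.
Unset Printing Implicit Defensive.

Definition is_part (n : nat) (s : seq nat) : bool :=
  [&& sorted geq s, all (ltn 0) s & sumn s == n].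

Record intpart (n : nat) : predArgType :=
  IntPart { parts :> seq nat; _ : is_part n parts }.

HB.instance Definition _ n := [isSub for @parts n].
HB.instance Definition _ n := [Countable of intpart n by <:].

Lemma is_part_bounds n s :
  is_part n s -> (size s <= n) /\ {in s, forall x, x <= n}.
Proof.
case/and3P=> _ + /eqP<-; elim: s => [|y s IHs] //= /andP[y_gt0 /IHs[szs les]].
split=> [|x]; first by rewrite -add1n leq_add.
rewrite inE => /predU1P[->|/les lexs]; first exact: leq_addr.
exact: leq_trans lexs (leq_addl _ _).
Qed.

(* Finiteness: a partition of n has at most n parts, all at most n. *)
Definition intpart_code n (p : intpart n) : n.-bseq 'I_n.+1 :=
  insub_bseq n [seq inord x | x <- parts p].

Definition intpart_decode n (b : n.-bseq 'I_n.+1) : option (intpart n) :=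
  insub [seq nat_of_ord i | i <- b].

Lemma intpart_codeK n : pcancel (@intpart_code n) (@intpart_decode n).
Proof.
case=> s s_part; have [szs les] := is_part_bounds s_part.
rewrite /intpart_decode /intpart_code /insub_bseq /= val_insubd size_map szs.
rewrite -map_comp map_id_in => [|x /les lexn /=]; last by rewrite inordK.
by rewrite insubT.
Qed.

HB.instance Definition _ n : isFinite (intpart n) :=
  PCanIsFinite (@intpart_codeK n).

Definition p_e (n m : nat) : nat :=
  #|[set p : intpart n | ~~ odd (count (dvdn m) p)]|.

Definition p_o (n m : nat) : nat :=
  #|[set p : intpart n | odd (count (dvdn m) p)]|.

Definition q_o (n r : nat) : nat :=
  #|[set p : intpart n | ~~ has (dvdn (2 * r)) p
                         & uniq [seq x <- p | r %| x]]|.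

(* Main.v *)
Require Import Defs.
From mathcomp Require Import all_boot.
From mathcomp Require Import zify.

(** Sign a partition by the parity of its number of parts divisible by [2 * r].
    Replacing one part [2 * d] by two parts [d], where [r] divides [d], or
    conversely, flips the sign.  Doing this at the largest [d] for which one of
    the two moves is available is an involution: after the move the reverse
    move is available at [d], and nothing above [d] has changed.  The partitions
    with no available move are those counted by [q_o n r]. *)

Set Implicit Arguments.
Unset Strict Implicit.
Unset Printing Implicit Defensive.

Definition mult (s : seq nat) (x : nat) : nat := count_mem x s.

Lemma mem_mult s x : (x \in s) = (0 < mult s x).
Proof. by rewrite /mult -has_pred1 has_count. Qed.

Lemma mult_cons y s x : mult (y :: s) x = (y == x) + mult s x.
Proof. by []. Qed.

Lemma perm_mult s t x : perm_eq s t -> mult s x = mult t x.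
Proof. by move=> /permP st; apply: st. Qed.

Section Toggle.

Variable r : nat.
Implicit Types (s t : seq nat) (d e : nat).

Definition movable s d := (r %| d) && ((2 * d \in s) || (1 < mult s d)).

(* The value 0 means that no move is available, see [movable_gt0]. *)
Definition top s := \max_(d < (sumn s).+1 | movable s d) d.

(** Splitting takes precedence when both moves are available at [d]. The result is left unsorted, so
    the statements about it are up to permutation. *)
Definition toggle d s :=
  if 2 * d \in s then d :: d :: rem (2 * d) s else 2 * d :: rem d (rem d s).

Definition flip s := if top s == 0 then s else sort geq (toggle (top s) s).

Lemma mem_le_sumn s x : x \in s -> x <= sumn s.
Proof.
elim: s => //= y s IHs; rewrite inE => /predU1P[->|/IHs]; first exact: leq_addr.
by move=> le_xs; apply: leq_trans le_xs (leq_addl _ _).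
Qed.

Lemma movable_gt0 s d : all (ltn 0) s -> movable s d -> 0 < d.
Proof.
move=> s_gt0; have s0 : 0 \notin s by apply/negP => /(allP s_gt0).
case: d => // /andP[_ /orP[]]; first by rewrite muln0 (negPf s0).
by rewrite /mult (count_memPn s0).
Qed.

Lemma movable_le_top s d : movable s d -> d <= top s.
Proof.
move=> sd; have lt_d : d < (sumn s).+1.
  case/andP: sd => _ /orP[/mem_le_sumn|s_d]; first by lia.
  by rewrite ltnS mem_le_sumn // mem_mult; lia.
by have /= := @leq_bigmax_cond _ (fun i : 'I__ => movable s i)
                (@nat_of_ord _) (Ordinal lt_d) sd.
Qed.

Lemma movable_top s : top s != 0 -> movable s (top s).
Proof.
have [i si | s0] := pickP (fun i : 'I_(sumn s).+1 => movable s i).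
  move=> _; have [//|j sj] := @eq_bigmax_cond _
    [pred i : 'I_(sumn s).+1 | movable s i] (@nat_of_ord _).
    by rewrite (cardD1 i) inE si.
  by rewrite /top => ->.
by rewrite /top big_pred0.
Qed.

Lemma top_eqP s d : movable s d -> (forall e, d < e -> ~~ movable s e) ->
  top s = d.
Proof.
move=> sd dmax; have le_d := movable_le_top sd.
have [/eqP|/movable_top st] := boolP (top s == 0); first by lia.
by have [/dmax|] := ltnP d (top s); [rewrite st | lia].
Qed.

(** Free of [rem]: counting any predicate on both sides of the permutation turns a move into a
    linear equation. *)
Variant toggle_spec d s : seq nat -> Prop :=
| ToggleSplit t of 2 * d \in s & perm_eq (2 * d :: t) [:: d, d & s] :
    toggle_spec d s t
| ToggleMerge t of 2 * d \notin s & perm_eq [:: d, d & t] (2 * d :: s) :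
    toggle_spec d s t.

Lemma toggleP s d : movable s d -> toggle_spec d s (toggle d s).
Proof.
rewrite /movable /toggle => /andP[_]; case: ifPn => [s2d _ | s2d /= sd].
  apply: ToggleSplit => //; apply/permP => a /=.
  by rewrite (permP (perm_to_rem s2d)) /=; lia.
have s_d : d \in s by rewrite mem_mult; lia.
have s_d' : d \in rem d s.
  by move: sd; rewrite (perm_mult _ (perm_to_rem s_d)) mult_cons eqxx mem_mult; lia.
apply: ToggleMerge => //; apply/permP => a /=.
by rewrite (permP (perm_to_rem s_d)) /= (permP (perm_to_rem s_d')) /=; lia.
Qed.

Lemma perm_movable s t d : perm_eq s t -> movable s d = movable t d.
Proof. by move=> st; rewrite /movable (perm_mem st) (perm_mult _ st). Qed.

Lemma perm_top s t : perm_eq s t -> top s = top t.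
Proof.
move=> st; rewrite /top (perm_sumn st).
by apply: eq_bigl => d; rewrite (perm_movable _ st).
Qed.

Lemma perm_toggle s t d : perm_eq s t -> perm_eq (toggle d s) (toggle d t).
Proof.
move=> st; rewrite /toggle (perm_mem st).
have rem_perm s1 s2 x : perm_eq s1 s2 -> perm_eq (rem x s1) (rem x s2).
  by move=> s12; apply/permP => a; rewrite !count_rem (perm_mem s12) (permP s12).
by case: ifP => _; rewrite !perm_cons !rem_perm.
Qed.

(** Among values above [d = top s], only the multiplicity of [2 * d] changes, and it stays at most
    1, so no move appears above [d]. The reverse move keeps [d] itself movable. *)
Lemma top_toggle s : top s != 0 -> top (toggle (top s) s) = top s.
Proof.
move=> s_act; have sd := movable_top s_act.
have dmax e : top s < e -> ~~ movable s e.
  by apply: contraL => /movable_le_top; rewrite leqNgt.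
move: (top s) s_act sd dmax => d d_gt0 sd dmax.
have rd : r %| d by case/andP: sd.
(* Since [d] is nonzero, [2 * d] lies above the maximum. Two copies of it could be merged there, so
   it occurs at most once. *)
have /negP s2d := dmax (2 * d) ltac:(lia).
have {}s2d : mult s (2 * d) <= 1.
  by rewrite leqNgt; apply/negP => c; apply: s2d; rewrite /movable dvdn_mull ?c ?orbT.
apply: top_eqP => [|e lt_de].
  case: (toggleP sd) => t _ tE; rewrite /movable rd !mem_mult /=.
    by move: (perm_mult d tE); rewrite !mult_cons eqxx; lia.
  by move: (perm_mult (2 * d) tE); rewrite !mult_cons eqxx; lia.
have := dmax e lt_de; apply: contra; rewrite /movable => /andP[-> /=].
rewrite !mem_mult.
have mult_e u v x : perm_eq [:: d, d & u] (2 * d :: v) -> x > d ->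
  mult u x = (2 * d == x) + mult v x.
  by move=> uv lt_dx; move: (perm_mult x uv); rewrite !mult_cons; lia.
case: (toggleP sd) => t; rewrite mem_mult => s2d' tE.
  rewrite perm_sym in tE; move: (mult_e _ _ e tE) (mult_e _ _ (2 * e) tE); lia.
move: (mult_e _ _ e tE) (mult_e _ _ (2 * e) tE).
(* A merge happens only when [2 * d] is absent, so it creates a single copy and no merge at
   [e = 2 * d]. *)
by case: (eqVneq (2 * d) e) s2d' => [<-|]; lia.
Qed.

(** With at most one part [2 * d], a split removes the last one and a merge creates one, so the
    second toggle is the opposite move. *)
Lemma toggleK s d : movable s d -> mult s (2 * d) <= 1 -> 0 < d ->
  movable (toggle d s) d -> perm_eq (toggle d (toggle d s)) s.
Proof.
move=> sd s1 d_gt0; case: (toggleP sd) => t s2d tE td;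
  case: (toggleP td) => u t2d uE; last 1 first.
- move: t2d; rewrite mem_mult; move: (perm_mult (2 * d) tE).
  by rewrite !mult_cons eqxx; lia.
- move: t2d; rewrite mem_mult; move: (perm_mult (2 * d) tE).
  by rewrite !mult_cons eqxx; lia.
- by apply/permP => a; move/permP/(_ a): tE; move/permP/(_ a): uE => /=; lia.
by apply/permP => a; move/permP/(_ a): tE; move/permP/(_ a): uE => /=; lia.
Qed.

(** The part [2 * d] is a multiple of [2 * r] and counts once, while the two copies of [d] together
    count 0 or 2. *)
Lemma odd_toggle s d : movable s d ->
  odd (count (dvdn (2 * r)) (toggle d s)) = ~~ odd (count (dvdn (2 * r)) s).
Proof.
move=> sd; have rd : 2 * r %| 2 * d by rewrite dvdn_pmul2l //; case/andP: sd.
by case: (toggleP sd) => t _ /permP /(_ (dvdn (2 * r))) /=; rewrite rd; lia.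
Qed.

Lemma perm_flip s : top s != 0 -> perm_eq (flip s) (toggle (top s) s).
Proof. by rewrite /flip => /negPf->; rewrite perm_sort. Qed.

Lemma top_flip s : top (flip s) = top s.
Proof.
have [s0|s_act] := eqVneq (top s) 0; first by rewrite /flip s0.
by rewrite (perm_top (perm_flip s_act)) top_toggle.
Qed.

Lemma geq_trans : transitive geq.
Proof. by move=> y x z /= le_yx le_zy; apply: leq_trans le_zy le_yx. Qed.

Lemma flip_part n s : is_part n s -> is_part n (flip s).
Proof.
have [s0|s_act] := eqVneq (top s) 0; first by rewrite /flip s0.
case/and3P => _ s_gt0 /eqP s_n; have sd := movable_top s_act.
have fs := perm_flip s_act; apply/and3P; split.
- by rewrite /flip (negPf s_act); apply: sort_sorted => x y; apply: leq_total.
(* Positivity of all parts is recast as an equality of a count with the size, which the permutation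
   equation transports. *)
- move: s_gt0; rewrite (perm_all _ fs) !all_count => /eqP s_gt0.
  have s2 : (0 < 2 * top s) by lia.
  have s1 : (0 < top s) by lia.
  case: (toggleP sd) => t _ tE; move/permP: (tE) (perm_size tE) => /(_ (ltn 0)) /=;
    by rewrite s1 s2; lia.
rewrite (perm_sumn fs); case: (toggleP sd) => t _ /perm_sumn /=; lia.
Qed.

Lemma flipK n s : is_part n s -> flip (flip s) = s.
Proof.
move=> s_n; have [s0|s_act] := eqVneq (top s) 0; first by rewrite /flip s0 /= s0.
have /and3P[s_sorted _ _] := s_n.
have tf := top_flip s; have sd := movable_top s_act.
have /and3P[ff_sorted _ _] := flip_part (flip_part s_n).
(* Both lists are sorted, so equality up to permutation suffices. *)
apply: (sorted_eq geq_trans _ ff_sorted s_sorted) => [x y|]; first by rewrite /geq /=; lia.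
have fs_act : top (flip s) != 0 by rewrite tf.
rewrite (permPl (perm_flip fs_act)) tf.
rewrite (permPl (perm_toggle (top s) (perm_flip s_act))).
apply: toggleK; rewrite ?lt0n //; last first.
  by rewrite -{2}(top_toggle s_act) movable_top // top_toggle.
rewrite leqNgt; apply/negP => c; have := @movable_le_top s (2 * top s).
by rewrite /movable dvdn_mull ?c ?orbT /=; [move/(_ isT); lia | case/andP: sd].
Qed.

Lemma odd_flip s : top s != 0 ->
  odd (count (dvdn (2 * r)) (flip s)) = ~~ odd (count (dvdn (2 * r)) s).
Proof.
move=> s_act; rewrite (permP (perm_flip s_act)) odd_toggle //.
exact: movable_top.
Qed.

(** A part [2 * (k * r)] is exactly what can be split, and a repeated multiple of [r] is exactly
    what can be merged. Positivity excludes a move at 0, which [top] could not detect. *)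
Lemma top_eq0 s : all (ltn 0) s ->
  (top s == 0) = ~~ has (dvdn (2 * r)) s && uniq [seq x <- s | r %| x].
Proof.
move=> s_gt0; apply/idP/andP => [/eqP s0 | [/hasPn s2 us]].
  have nomove d : movable s d = false.
    by apply/negP => sd; have := movable_le_top sd; have := movable_gt0 s_gt0 sd; lia.
  split.
    apply/hasPn => x sx; apply/negP => /dvdnP[k xE]; have := nomove (k * r).
    have -> : movable s (k * r) = true; last by [].
    by rewrite /movable dvdn_mull // mulnCA -xE sx.
  apply: count_mem_uniq => x; rewrite mem_filter count_filter.
  have [rx|rx] /= := boolP (r %| x); last first.
    by rewrite -(count_pred0 s); apply: eq_count => y /=; case: eqP => // ->; apply/negbTE.
  rewrite (@eq_count _ _ (pred1 x)); last by move=> y /=; case: eqP => // ->.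
  rewrite -/(mult s x) (mem_mult s x); have := nomove x.
  by rewrite /movable rx /=; case: (mult s x) => [|[|c]] //; rewrite orbT.
apply/negPn/negP => /movable_top /andP[rd /orP[/s2|]].
  by rewrite dvdn_pmul2l // rd.
have := count_uniq_mem (top s) us; rewrite count_filter.
rewrite (@eq_count _ _ (pred1 (top s))); last by move=> y /=; case: eqP => // ->.
by rewrite /mult => ->; case: (_ \in _).
Qed.

End Toggle.

Lemma intpartP n (p : intpart n) : is_part n p.
Proof. exact: valP. Qed.

Definition flip_intpart r n (p : intpart n) : intpart n :=
  IntPart (flip_part r (intpartP p)).

Lemma flip_intpartK r n : involutive (@flip_intpart r n).
Proof. by move=> p; apply: val_inj; apply: flipK (intpartP p). Qed.

Theorem theorem1p4 (r : nat) (hr : 0 < r) (n : nat) :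
  p_e n (2 * r) = p_o n (2 * r) + q_o n r.
Proof.
pose act := [set p : intpart n | top r p != 0].
have p_gt0 (p : intpart n) : all (ltn 0) p by case/and3P: (intpartP p).
rewrite /p_e -(cardsID act); congr (_ + _); last first.
  (* On partitions without a move the evenness condition is automatic: the count of multiples of
     [2 * r] is 0. *)
  apply: eq_card => p; rewrite !inE negbK top_eq0 //.
  have [//|p0] := boolP (has _ _); rewrite has_count lt0n negbK in p0.
  by rewrite (eqP p0) andbT.
(* The even partitions with a move are carried by the involution onto the odd ones with a move. *)
rewrite -(card_imset _ (inv_inj (@flip_intpartK r n))).
rewrite (can2_imset_pre _ (@flip_intpartK r n) (@flip_intpartK r n)).
apply: eq_card => p; rewrite !inE /= top_flip //.
(* An odd partition always has a move, since without one its count would be 0. *)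
have [p0|p_act] := eqVneq (top r p) 0; last by rewrite odd_flip // negbK andbT.
rewrite andbF; move/eqP: p0; rewrite top_eq0 // => /andP[+ _].
by rewrite has_count lt0n negbK => /eqP->.
Qed.
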